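(* Consider the Snowflake protocol or the Snowball protocol with fixed $n,k,\alpha$ ($\frac k2<\alpha\le k$), security parameter $\beta$, and a weak $F$-bounded adversary, where $2\le F<n$. Let $\pi$ be any fixed polynomial. Then the following two properties are mutually exclusive, i.e. they cannot both hold against every weak $F$-bounded adversary: (A) the protocol ensures consensus with all but negligible probability with respect to $\beta$, i.e. there is a polynomial $\rho$ such that when the protocol with parameter $\beta$ is executed for at least $\rho(\beta)$ rounds, the probability that one of the consensus conditions (termination, validity, integrity, agreement) is violated is negligible in $\beta$; (B) parties decide with fewer than $\pi(\beta)$ queries with all but negligible probability with respect to $\beta$. This holds even when the consensus conditions are only required for the parties not influenced by the adversary.
   Context: A function $f(\beta)\ge 0$ is negligible in $\beta$ if for every polynomial $\pi'$ (positive for large arguments) there is $\beta_0$ such that $f(\beta)\le 1/\pi'(\beta)$ for all $\beta\ge\beta_0$; an event holds with all but negligible probability if its complement has negligible probability. Consensus conditions: Termination: every party eventually decides on some opinion. Validity: if all parties propose the same value, then all parties decide on that value. Integrity: no party decides twice. Agreement: no two parties decide differently. Both protocols: there are $n$ parties, each holding an opinion $b\in\{0,1\}$, initially the value it proposes, and a counter $cnt$, initially $0$. In each synchronous round every undecided party makes one query: it independently draws $k$ parties uniformly at random with repetition from all $n$ parties (independently across parties and rounds) and observes their current opinions. The query has an $\alpha$-majority for $b'$ if at least $\alpha$ of the observed opinions equal $b'$. Snowflake: on an $\alpha$-majority for $b'$: if $b'=b$ then $cnt\gets cnt+1$, else $b\gets b'$ and $cnt\gets 1$; if there is no $\alpha$-majority,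 $cnt\gets 0$. Snowball: the party additionally keeps $d[0],d[1]$, initially $0$. On an $\alpha$-majority for $b'$: $d[b']\gets d[b']+1$; if $b'=b$ then $cnt\gets cnt+1$; else, if $d[b']>d[b]$ then $b\gets b'$, and in either case $cnt\gets 1$. If there is no $\alpha$-majority, $cnt\gets0$. In both protocols a party decides its opinion $b$ (irrevocably, keeping $b$ as its opinion) as soon as $cnt=\beta$. A weak $F$-bounded adversary controls up to $F$ undecided parties (the influenced parties), whose opinion it can set arbitrarily once each round; it can also reset any decision made by influenced parties. *)

(* Defs.v *)
From HB Require Import structures.
From mathcomp Require Import all_boot all_order all_algebra.
From mathcomp Require Import reals.

Set Implicit Arguments.
Unset Strict Implicit.
Unset Printing Implicit Defensive.

Import Order.TTheory GRing.Theory Num.Theory.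

Inductive protocol := Snowflake | Snowball.

Record pstate := PState {
  opinion : bool;
  cnt : nat;
  d : bool -> nat;          (* only used by Snowball *)
  decided : bool;
  decisions : seq bool;     (* every opinion decided so far, oldest first *)
  queries_made : nat
}.

Definition config n := 'I_n -> pstate.

Definition init n (proposal : 'I_n -> bool) : config n :=
  fun p => PState (proposal p) 0 (fun=> 0) false [::] 0.

(* The draws of one round: [s p j] is the [j]-th party drawn by [p].  Draws are
   provided for decided parties too, but these are ignored. *)
Definition sample n k : finType := {ffun 'I_n -> {ffun 'I_k -> 'I_n}}.

Section Round.
Variables (prot : protocol) (n k alpha beta : nat).

Definition votes (c : config n) (s : sample n k) (p : 'I_n) (b : bool) : nat :=
  #|[set j : 'I_k | opinion (c (s p j)) == b]|.

(* At most one opinion has an alpha-majority when [k < 2 * alpha]. *)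
Definition majority (c : config n) (s : sample n k) (p : 'I_n) : option bool :=
  if alpha <= votes c s p true then Some true
  else if alpha <= votes c s p false then Some false
  else None.

Definition update_flake (x : pstate) (m : option bool) : pstate :=
  let: PState b c dd dc ds q := x in
  match m with
  | Some b' => if b' == b then PState b c.+1 dd dc ds q
               else PState b' 1 dd dc ds q
  | None => PState b 0 dd dc ds q
  end.

Definition update_ball (x : pstate) (m : option bool) : pstate :=
  let: PState b c dd dc ds q := x in
  match m with
  | Some b' =>
      let dd' := fun a => dd a + (a == b') in
      if b' == b then PState b c.+1 dd' dc ds q
      else PState (if dd' b < dd' b' then b' else b) 1 dd' dc ds q
  | None => PState b 0 dd dc ds q
  end.

Definition update (x : pstate) (m : option bool) : pstate :=
  match prot with
  | Snowflake => update_flake x m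
  | Snowball => update_ball x m
  end.

Definition decide (x : pstate) : pstate :=
  let: PState b c dd dc ds q := x in
  if c == beta then PState b c dd true (rcons ds b) q else x.

Definition count_query (x : pstate) : pstate :=
  let: PState b c dd dc ds q := x in PState b c dd dc ds q.+1.

Definition query_round (s : sample n k) (c : config n) : config n :=
  fun p => if decided (c p) then c p
           else decide (update (count_query (c p)) (majority c s p)).

End Round.

Record action n := Action {
  resets : {set 'I_n};
  set_opinion : 'I_n -> option bool    (* [None]: leave the opinion as it is *)
}.

(* The strategy sees the whole transcript: for each past round (oldest first)
   the configuration in which it started and all its draws, then the current
   configuration.  It does not see the draws of the round about to start. *)
Record adversary n k F := Adversary {
  influenced : {set 'I_n};
  influenced_bound : #|influenced| <= F;
  strategy : seq (config n * sample n k) -> config n -> action n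
}.

(* A withdrawn decision leaves the party undecided with its counter restarted
   (otherwise [cnt = beta] would make it decide again at once). *)
Definition reset_decision (x : pstate) : pstate :=
  let: PState b c dd dc ds q := x in
  if dc then PState b 0 dd false ds q else x.

Definition overwrite (o : option bool) (x : pstate) : pstate :=
  let: PState b c dd dc ds q := x in
  if dc then x else PState (odflt b o) c dd dc ds q.

Definition interfere n (I : {set 'I_n}) (a : action n) (c : config n) : config n :=
  fun p =>
    if p \in I then
      overwrite (set_opinion a p)
        (if p \in resets a then reset_decision (c p) else c p)
    else c p.

Section Execution.
Variables (prot : protocol) (n k alpha beta F : nat).
Variables (adv : adversary n k F) (proposal : 'I_n -> bool).

Fixpoint exec_from (hist : seq (config n * sample n k)) (c : config n)
    (w : seq (sample n k)) : config n :=
  if w is s :: w' then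
    exec_from (rcons hist (c, s))
      (query_round prot alpha beta s
         (interfere (influenced adv) (strategy adv hist c) c)) w'
  else c.

Definition exec (w : seq (sample n k)) : config n :=
  exec_from [::] (init proposal) w.

Variable S : {set 'I_n}.

Definition decs (w : seq (sample n k)) (p : 'I_n) : seq bool :=
  decisions (exec w p).

Definition termination w : bool := [forall p in S, decs w p != [::]].

Definition validity w : bool :=
  [forall b : bool, [forall p : 'I_n, proposal p == b] ==>
     [forall p in S, (decs w p != [::]) && all (pred1 b) (decs w p)]].

Definition integrity w : bool := [forall p in S, size (decs w p) <= 1].

Definition agreement w : bool :=
  [forall p in S, forall q in S,
     all (fun b => all (pred1 b) (decs w q)) (decs w p)].

Definition consensus w : bool :=
  [&& termination w, validity w, integrity w & agreement w].

Definition all_decide_within (R : realType) (bound : R) w : bool :=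
  [forall p in S, [exists t : 'I_(size w).+1,
     (decs (take t w) p != [::]) &&
     ((queries_made (exec (take t w) p))%:R < bound)%R]].

End Execution.

(* Uniform probability on the draws of [T] rounds: all draws are independent
   and uniform, across parties and rounds. *)
Definition Pr (R : realType) n k T (E : pred (seq (sample n k))) : R :=
  (#|[set w : T.-tuple (sample n k) | E w]|%:R / #|{: T.-tuple (sample n k)}|%:R)%R.

Definition negligible (R : realType) (f : nat -> R) : Prop :=
  forall q : {poly R},
    (exists N : nat, forall m : nat, N <= m -> (0 < q.[m%:R])%R) ->
    exists beta0 : nat, forall beta : nat, beta0 <= beta ->
      (f beta <= 1 / q.[beta%:R])%R.

Inductive scope := AllParties | UninfluencedOnly.

Definition required n k F (sc : scope) (adv : adversary n k F) : {set 'I_n} :=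
  match sc with
  | AllParties => setT
  | UninfluencedOnly => ~: influenced adv
  end.

(* An adversary for every [beta], as its strategy may depend on [beta]. *)
Section Properties.
Variables (R : realType) (prot : protocol) (n k alpha F : nat) (sc : scope).

Definition ensures_consensus (adv : nat -> adversary n k F) : Prop :=
  exists rho : {poly R},
  forall rounds : nat -> nat,
    (forall beta, (rho.[beta%:R] <= (rounds beta)%:R)%R) ->
  forall proposal : nat -> 'I_n -> bool,
    negligible (fun beta => Pr R (rounds beta) (fun w : seq (sample n k) =>
      ~~ consensus prot alpha beta (adv beta) (proposal beta)
           (required sc (adv beta)) w)).

(* Until its first decision a party queries in every round, so the event is
   settled within the first [pi beta] rounds and does not depend on [rounds]. *)
Definition decides_within (pi : {poly R}) (adv : nat -> adversary n k F) : Prop :=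
  forall rounds : nat -> nat,
    (forall beta, (pi.[beta%:R] <= (rounds beta)%:R)%R) ->
  forall proposal : nat -> 'I_n -> bool,
    negligible (fun beta => Pr R (rounds beta) (fun w : seq (sample n k) =>
      ~~ all_decide_within prot alpha beta (adv beta) (proposal beta)
           (required sc (adv beta)) pi.[beta%:R]%R w)).

End Properties.

(* Main.v *)
(* Property (B) already fails for a suitable adversary.  It influences two
   parties, cancels all their decisions and pins their opinions to 0 and to 1.
   With N the number of possible draws of one round, in every round each opinion
   has probability at least 1/N of being the majority seen by a third party: all
   draws may hit the party pinned to that opinion.  Deciding requires beta - 1
   consecutive rounds in which one of these two draws never occurs, so a union
   bound over the window shows that the third party decides within T rounds with
   probability at most 2 (T + 1) (1 - 1/N)^(beta - 1).  For T polynomial in beta this is eventually below 1/2. *)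
Require Import Defs.
From HB Require Import structures.
From mathcomp Require Import all_boot all_order all_algebra.
From mathcomp Require Import reals.
From mathcomp Require Import zify.

Set Implicit Arguments.
Unset Strict Implicit.
Unset Printing Implicit Defensive.

Import Order.TTheory GRing.Theory Num.Theory.

(** * Exponentials against polynomials *)

Lemma exp2_dominates_monomial (D m j0 : nat) :
  exists2 j, j0 < j & D * j ^ m <= 2 ^ j.
Proof.
pose u := 2 * (D + m) + j0.
have lt_u : u < 2 ^ u by apply: ltn_expl.
(* For [j] a power of two, [j ^ m] is one too, and only exponents remain to be compared: D + 2um <=
   (u + 1)^2 <= 2^(2u), using D <= 2^D. *)
exists (2 ^ (2 * u)).
  by apply: leq_ltn_trans (ltn_expl (2 * u) (isT : 1 < 2)); rewrite /u; lia.
rewrite -expnM.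
apply: (@leq_trans (2 ^ D * 2 ^ (2 * u * m))).
  by rewrite leq_mul2r (ltnW (ltn_expl D _)) ?orbT.
rewrite -expnD leq_exp2l //.
have : u.+1 ^ 2 <= (2 ^ u) ^ 2 by rewrite leq_exp2r.
rewrite -expnM (mulnC u); apply: leq_trans.
by rewrite -mulnn /u; nia.
Qed.

(** In the binomial expansion of ((N - 1) + 1)^N, the first two terms are each at least (N -
    1)^N. *)
Lemma double_pred_expn (N : nat) : 0 < N -> 2 * N.-1 ^ N <= N ^ N.
Proof.
case: N => // N _ /=.
have -> : N.+1 ^ N.+1 = (N + 1) ^ N.+1 by rewrite addn1.
rewrite expnDn big_ord_recl big_ord_recl /= subn0 bin0 /bump /= !exp1n !muln1.
by rewrite bin1 expnS subn1 /=; nia.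
Qed.

Lemma polynomial_geometric_small (N C m beta0 : nat) : 0 < N ->
  exists2 beta, beta0 <= beta &
    4 * (C * beta.+1 ^ m).+1 * N.-1 ^ beta.-1 <= N ^ beta.-1.
Proof.
move=> N_gt0.
have [j lt_j leD] := exp2_dominates_monomial (4 * C.+1 * (N + 2) ^ m) m beta0.
(* With beta - 1 = N * j, [double_pred_expn] gains a factor 2 for each of the [j] blocks of length
   [N], and 2^j beats the polynomial. *)
exists (N * j).+1; first by nia.
rewrite /= !expnM.
apply: (@leq_trans ((2 * N.-1 ^ N) ^ j)); last first.
  by rewrite leq_exp2r ?double_pred_expn //; lia.
rewrite expnMn leq_mul2r; apply/orP; right.
apply: leq_trans leD.
rewrite -mulnA -expnMn -mulnA leq_mul2l /=.
have le1 : (N * j).+2 ^ m <= ((N + 2) * j) ^ m.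
  by case: (m) => // m'; rewrite leq_exp2r //; nia.
have : 0 < ((N + 2) * j) ^ m by rewrite expn_gt0; apply/orP; left; nia.
by move: le1; move: (_ ^ m) (_ ^ m) => a b; nia.
Qed.

(** Turns a real polynomial into a natural number of rounds; [C] bounds the sum of the absolute
    values of the coefficients. *)
Lemma horner_nat_le (R : realType) (p : {poly R}) :
  exists C : nat, forall x : nat,
    (p.[x%:R] <= (C * x.+1 ^ size p)%:R)%R.
Proof.
pose S := (\sum_(i < size p) `|p`_i|)%R.
exists (Num.bound S) => x.
have S_ge0 : (0 <= S)%R by apply: sumr_ge0.
rewrite natrM; apply: (@le_trans _ _ (S * (x.+1 ^ size p)%:R)%R); last first.
  by rewrite ler_wpM2r // ltW // archi_boundP.
rewrite horner_coef /S mulr_suml; apply: ler_sum => i _.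
apply: (le_trans (ler_norm _)); rewrite normrM ler_wpM2l // -natrX normr_nat ler_nat.
apply: (@leq_trans (x.+1 ^ i)); first by case: (val i) => // i'; rewrite leq_exp2r.
by rewrite leq_pexp2l // ltnW.
Qed.

(** * Counting tuples that avoid a letter in a window *)

Lemma card_tuple_avoid_window (A : finType) (a : A) (T l m : nat) :
  l + m <= T ->
  #|[set w : T.-tuple A | a \notin take m (drop l w)]|
    <= #|A|.-1 ^ m * #|A| ^ (T - m).
Proof.
move=> le_lmT.
pose P (i : 'I_T) := l <= i < l + m.
pose G (i : 'I_T) : pred A := if P i then predC1 a else predT.
(* Seen as functions, such tuples lie in a product of sets with one letter fewer at the [m] window
   positions. *)
pose f (w : T.-tuple A) : {ffun 'I_T -> A} := [ffun i => tnth w i].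
have f_inj : injective f.
  move=> w w' /ffunP eq_f; apply: eq_from_tnth => i.
  by have := eq_f i; rewrite !ffunE.
rewrite -(card_imset _ f_inj).
apply: (@leq_trans #|family G|).
  apply/subset_leq_card/subsetP => g /imsetP[w]; rewrite inE => a_notin ->.
  apply/familyP => i; rewrite ffunE /G; case: ifP => // /andP[le_li lt_i].
  rewrite inE; apply: contra a_notin => /eqP <-.
  have -> : tnth w i = nth a (take m (drop l w)) (i - l).
    by rewrite nth_take ?nth_drop ?subnKC ?(tnth_nth a) //; lia.
  by rewrite mem_nth // size_take size_drop size_tuple; case: ifP; lia.
have cardG i : #|G i| = if P i then #|A|.-1 else #|A|.
  by rewrite /G; case: ifP => _; rewrite ?cardC1.
rewrite card_family foldrE big_map big_enum /= (eq_bigr _ (fun i _ => cardG i)).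
have -> : \prod_(i < T) (if P i then #|A|.-1 else #|A|) =
          \prod_(0 <= i < T) (if l <= i < l + m then #|A|.-1 else #|A|).
  by rewrite big_mkord.
have const_prod a' b' x : a' <= b' ->
    (forall i, a' <= i < b' -> (if l <= i < l + m then #|A|.-1 else #|A|) = x) ->
    \prod_(a' <= i < b') (if l <= i < l + m then #|A|.-1 else #|A|) = x ^ (b' - a').
  by move=> le_ab eq_x; rewrite (eq_big_nat _ _ eq_x) prod_nat_const_nat.
have le_l : l <= l + m := leq_addr m l.
rewrite (@big_cat_nat _ _ _ l) ?(leq_trans le_l) //=.
rewrite (@big_cat_nat _ _ _ (l + m) l) //=.
rewrite (const_prod 0 l #|A|) //; last by move=> i ?; case: ifP; lia.
rewrite (const_prod l (l + m) #|A|.-1) //; last by move=> i ->.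
rewrite (const_prod (l + m) T #|A|) //; last by move=> i ?; case: ifP; lia.
rewrite addKn mulnCA -expnD.
by have -> : l - 0 + (T - (l + m)) = T - m by lia.
Qed.

(** * The pinning adversary and unanimous draws *)

Definition unanimous n k (q : 'I_n) : sample n k := [ffun=> [ffun=> q]].

(** [interfere] confines this to the influenced parties. It applies resets first, and [overwrite]
    leaves decided parties alone. *)
Definition pin_action n (pt : bool -> 'I_n) : action n :=
  Action setT (fun p => Some (p == pt true)).

Lemma pinned_bound n F (pt : bool -> 'I_n) :
  2 <= F -> #|[set pt false; pt true]| <= F.
Proof. by apply: leq_trans; rewrite cards2; case: (_ != _). Qed.

Definition pin_adversary n k F (HF2 : 2 <= F) (pt : bool -> 'I_n) :
    adversary n k F :=
  Adversary (pinned_bound pt HF2) (fun _ _ => pin_action pt).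

Lemma opinion_pinned n (pt : bool -> 'I_n) (c : config n) b :
  pt false != pt true ->
  opinion (interfere [set pt false; pt true] (pin_action pt) c (pt b)) = b.
Proof.
move=> pt_neq; rewrite /interfere /= !inE.
have -> : (pt b == pt false) || (pt b == pt true) by case: b; rewrite eqxx ?orbT.
case: (c (pt b)) => o m dd [] ds q /=; case: b; rewrite ?eqxx //.
all: exact: negbTE.
Qed.

(** The strategy ignores its history, so the last round can be peeled off although [exec_from]
    recurses from the first. *)
Lemma exec_from_pin_rcons prot n k alpha beta F (HF2 : 2 <= F)
    (pt : bool -> 'I_n) hist c (w : seq (sample n k)) s :
  let adv := pin_adversary k HF2 pt in
  exec_from prot alpha beta adv hist c (rcons w s) =
  query_round prot alpha beta s
    (interfere [set pt false; pt true] (pin_action pt)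
       (exec_from prot alpha beta adv hist c w)).
Proof. by move=> adv; elim: w hist c => [|s' w IHw] hist c //=; rewrite IHw. Qed.

Lemma majority_unanimous n k alpha (c : config n) (p q : 'I_n) :
  k < 2 * alpha -> alpha <= k ->
  majority alpha c (unanimous k q) p = Some (opinion (c q)).
Proof.
move=> Hmaj Halpha.
have votesE b : votes c (unanimous k q) p b = if opinion (c q) == b then k else 0.
  rewrite /votes -[X in if _ then X else _](card_ord k).
  case: ifP => eq_b; last by apply: eq_card0 => j; rewrite !inE !ffunE eq_b.
  by apply: eq_card => j; rewrite !inE !ffunE eq_b.
rewrite /majority !votesE; case: (opinion (c q)) => /=; first by rewrite Halpha.
by rewrite Halpha leqNgt; have -> : 0 < alpha by lia.
Qed.

(** * Majority streaks before a decision *)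

Lemma decided_update prot x m : decided (update prot x m) = decided x.
Proof. by case: prot; case: x => b c dd dc ds q; case: m => [b'|] //=; case: ifP. Qed.

Lemma decisions_update prot x m : decisions (update prot x m) = decisions x.
Proof. by case: prot; case: x => b c dd dc ds q; case: m => [b'|] //=; case: ifP. Qed.

(** Under both protocols only a majority for the held opinion increments the counter; every other
    case sets it to 0 or 1. *)
Lemma update_streak prot x m (y := update prot x m) :
  cnt y <= 1 \/
  [/\ m = Some (opinion x), opinion y = opinion x & cnt y = (cnt x).+1].
Proof.
rewrite {}/y; case: prot; case: x => b c dd dc ds q; case: m => [b'|] /=; try by left.
all: by case: eqP => [->|_]; [right | left].
Qed.

(* The invariant: while the party is undecided, each of its last cnt - 1 rounds
   had a majority for its opinion, hence was not the unanimous draw of the party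
   pinned to the opposite one.  The first majority of a streak is left out since
   in Snowball it may have gone against the opinion. *)
Lemma decision_needs_window prot n k alpha beta F (HF2 : 2 <= F)
    (pt : bool -> 'I_n) (proposal : 'I_n -> bool) (p : 'I_n)
    (w : seq (sample n k)) :
  k < 2 * alpha -> alpha <= k -> pt false != pt true ->
  p \notin [set pt false; pt true] ->
  decs prot alpha beta (pin_adversary k HF2 pt) proposal w p != [::] ->
  exists b l, l + beta.-1 <= size w /\
    unanimous k (pt b) \notin take beta.-1 (drop l w).
Proof.
move=> Hmaj Halpha pt_neq p_free.
pose adv := pin_adversary k HF2 pt.
pose ex w := exec prot alpha beta adv proposal w p.
pose window w := exists b l, l + beta.-1 <= size w /\
    unanimous k (pt b) \notin take beta.-1 (drop l w).
(* The streak is tracked up to the first decision; afterwards only the window it produced is carried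
   along. *)
suff: if decisions (ex w) == [::] then
    [/\ ~~ decided (ex w), cnt (ex w) <= size w &
      unanimous k (pt (~~ opinion (ex w)))
        \notin drop (size w - (cnt (ex w)).-1) w]
  else window w.
  by rewrite -/(ex w) /decs -/(ex w); case: ifP.
elim/last_ind: w => [|w s IHw] //=.
have window_rcons : window w -> window (rcons w s).
  move=> [b [l [le_l b_notin]]]; exists b, l; rewrite size_rcons; split; first by lia.
  rewrite drop_rcons; last by lia.
  by rewrite -cats1 takel_cat // size_drop; lia.
pose c' := interfere [set pt false; pt true] (pin_action pt)
             (exec prot alpha beta adv proposal w).
have exS : ex (rcons w s) = query_round prot alpha beta s c' p.
  by rewrite /ex /exec exec_from_pin_rcons.
have c'p : c' p = ex w by rewrite /c' /interfere (negbTE p_free).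
rewrite exS /query_round c'p; move: IHw.
case: (boolP (decided (ex w))) => [dec|undec].
  by case: ifP => [_ []|_ /window_rcons].
set x := count_query (ex w).
have [cntx opx decx dsx] : [/\ cnt x = cnt (ex w), opinion x = opinion (ex w),
    decided x = decided (ex w) & decisions x = decisions (ex w)].
  by rewrite /x; case: (ex w).
set y := update prot x (majority alpha c' s p).
have ydec : decided y = decided (ex w) by rewrite decided_update.
have yds : decisions y = decisions (ex w) by rewrite decisions_update.
case: eqP => [ds0 [_ le_cnt u_notin]|ds_neq0 /window_rcons win]; last first.
  case: ifP => // /eqP; rewrite -yds in ds_neq0; move: ds_neq0.
  rewrite /decide; case: (y) => b m dd dc ds q /= ds_neq0.
  by case: ifP => _ //=; case: (ds).
have streak : cnt y <= (size w).+1 /\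
    unanimous k (pt (~~ opinion y)) \notin drop ((size w).+1 - (cnt y).-1) (rcons w s).
  have := update_streak prot x (majority alpha c' s p); rewrite -/y /=.
  case=> [cnt_le1|[maj_eq op_eq cnt_eq]].
    split; first exact: leq_trans cnt_le1 _.
    have -> : (cnt y).-1 = 0 by move: cnt_le1; case: (cnt y) => [|[]].
    by rewrite subn0 drop_oversize // size_rcons.
  rewrite op_eq cnt_eq cntx opx; split=> //=.
  have s_neq : unanimous k (pt (~~ opinion (ex w))) != s.
    apply/eqP => eq_s; move: maj_eq.
    rewrite -eq_s majority_unanimous // opinion_pinned // opx => -[].
    by case: (opinion _).
  (* A streak that just reached 1 has an empty window; a longer one keeps its starting index. *)
  have [->|cnt_gt0] := posnP (cnt (ex w)).
    by rewrite subn0 drop_oversize // size_rcons.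
  have -> : (size w).+1 - cnt (ex w) = size w - (cnt (ex w)).-1 by lia.
  by rewrite drop_rcons ?leq_subr // mem_rcons inE negb_or s_neq.
have y0 : decisions y = [::] by rewrite yds.
case: streak; rewrite -ydec in undec; move: y0 undec.
rewrite size_rcons /decide; case: (y) => b m dd dc ds q /= -> undec le_m notin.
case: (m =P beta) => [eq_m|_] /=; last by split.
exists (~~ b), ((size w).+1 - m.-1); rewrite size_rcons -eq_m; split.
  by rewrite subnK ?(leq_trans (leq_pred m)).
by apply: contra notin; apply: mem_take.
Qed.

(** * Union bound over windows *)

Lemma leq_card_bigcup (I T : finType) (B : I -> {set T}) :
  #|\bigcup_i B i| <= \sum_i #|B i|.
Proof.
apply: (big_rec2 (fun (X : {set T}) x => #|X| <= x)) => [|i X x _ le_Xx].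
  by rewrite cards0.
by apply: leq_trans (leq_card_setU _ _) _; rewrite leq_add2l.
Qed.

(** In the factor [4 * T.+1], one 2 pays for the two opinions, [T.+1] for the window starts, and the
    other 2 yields the probability 1/2. *)
Lemma Pr_not_all_decide_ge (R : realType) prot n k alpha beta F (HF2 : 2 <= F)
    (pt : bool -> 'I_n) (proposal : 'I_n -> bool) (p : 'I_n) (S : {set 'I_n})
    (T : nat) (bound : R) :
  k < 2 * alpha -> alpha <= k -> pt false != pt true ->
  p \notin [set pt false; pt true] -> p \in S ->
  4 * T.+1 * #|sample n k|.-1 ^ beta.-1 <= #|sample n k| ^ beta.-1 ->
  (2^-1 <= Pr R T (fun w : seq (sample n k) =>
     ~~ all_decide_within prot alpha beta (pin_adversary k HF2 pt) proposal S
          bound w))%R.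
Proof.
move=> Hmaj Halpha pt_neq p_free pS small.
set N := #|sample n k| in small *.
have N_gt0 : 0 < N by apply/card_gt0P; exists (unanimous k p).
set E := fun w => ~~ _; pose m := beta.-1.
pose D := [set w : T.-tuple (sample n k) | ~~ E w].
(* The guard discards truncated windows, which would exclude the draw from fewer than [m] rounds. *)
pose W b l := [set w : T.-tuple (sample n k) |
  (l + m <= T) && (unanimous k (pt b) \notin take m (drop l w))].
have D_sub : D \subset \bigcup_(b : bool) \bigcup_(l < T.+1) W b l.
  apply/subsetP => w; rewrite inE negbK => /forall_inP/(_ p pS)/existsP[t /andP[dec _]].
  have := ltn_ord t; rewrite [in X in _ < X -> _]size_tuple ltnS.
  move: (nat_of_ord t) dec => {}t dec le_t.
  have [b [l [le_l notin]]] := decision_needs_window Hmaj Halpha pt_neq p_free dec.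
  rewrite size_takel ?size_tuple // in le_l.
  have lt_l : l < T.+1 by lia.
  apply/bigcupP; exists b => //; apply/bigcupP; exists (Ordinal lt_l) => //.
  rewrite inE /=; apply/andP; split; first by lia.
  by move: notin; rewrite !take_drop take_takel 1?addnC.
have cardW b l : #|W b l| * N ^ m <= N.-1 ^ m * N ^ T.
  rewrite /W; case: (leqP (l + m) T) => [le_lm|_]; last first.
    by rewrite eq_card0 // => w; rewrite !inE.
  apply: leq_trans (leq_mul (card_tuple_avoid_window _ le_lm) (leqnn _)) _.
  by rewrite -mulnA -expnD subnK //; lia.
have cardD : 2 * #|D| <= N ^ T.
  have leD : #|D| * N ^ m <= 2 * T.+1 * (N.-1 ^ m * N ^ T).
    have leDsum : #|D| <= \sum_(b : bool) \sum_(l < T.+1) #|W b l|.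
      apply: leq_trans (subset_leq_card D_sub) _.
      apply: leq_trans (leq_card_bigcup _) _.
      by apply: leq_sum => b _; apply: leq_card_bigcup.
    apply: leq_trans (leq_mul leDsum (leqnn _)) _.
    apply: (@leq_trans (\sum_(b : bool) \sum_(l < T.+1) N.-1 ^ m * N ^ T)).
      rewrite big_distrl; apply: leq_sum => b _.
      by rewrite big_distrl; apply: leq_sum => l _; apply: cardW.
    by rewrite !sum_nat_const card_bool card_ord mulnA.
  have N_m : 0 < N ^ m by rewrite expn_gt0 N_gt0.
  rewrite -(leq_pmul2r N_m) -mulnA.
  apply: leq_trans (leq_mul (leqnn 2) leD) _.
  have := leq_mul small (leqnn (N ^ T)); rewrite -/m; nia.
have cardE : N ^ T = #|[set w : T.-tuple (sample n k) | E w]| + #|D|.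
  rewrite -card_tuple -(cardsC [set w : T.-tuple _ | E w]); congr (_ + _).
  by apply: eq_card => w; rewrite !inE.
rewrite /Pr card_tuple ler_pdivlMr ?ltr0n ?expn_gt0 ?N_gt0 //.
rewrite mulrC ler_pdivrMr ?ltr0n // -natrM ler_nat -/N; lia.
Qed.

Theorem theorem6p4 (R : realType) (prot : protocol) (n k alpha F : nat)
    (Hmaj : k < 2 * alpha) (Halpha : alpha <= k)
    (HF2 : 2 <= F) (HFn : F < n)
    (pi : {poly R}) (scA scB : scope) :
  ~ (forall adv : nat -> adversary n k F,
       ensures_consensus R prot alpha scA adv /\
       decides_within prot alpha scB pi adv).
Proof.
have n_gt2 : 2 < n by apply: leq_ltn_trans HFn.
pose pt (b : bool) : 'I_n :=
  if b then Ordinal (ltnW n_gt2) else Ordinal (ltnW (ltnW n_gt2)).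
pose p := Ordinal n_gt2.
have p_free : p \notin [set pt false; pt true] by rewrite !inE.
pose adv := pin_adversary k HF2 pt.
move/(_ (fun=> adv)) => -[_ fast].
have [C piC] := horner_nat_le pi.
pose T beta := C * beta.+1 ^ size pi.
(* Against the constant polynomial 3, negligibility would force a failure probability of at most
   1/3, below the 1/2 obtained here. *)
have [|beta0] := fast T piC (fun _ _ => true) 3%:R%:P%R.
  by exists 0 => m _; rewrite hornerC.
have N_gt0 : 0 < #|sample n k| by apply/card_gt0P; exists (unanimous k p).
have [beta le_beta small] :=
  polynomial_geometric_small C (size pi) beta0 N_gt0.
move/(_ beta le_beta); rewrite hornerC; apply/negP; rewrite -ltNge.
apply: (@lt_le_trans _ _ (2^-1)%R); last first.
  apply: (@Pr_not_all_decide_ge _ _ _ _ _ _ _ HF2 pt _ p) => //.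
  by case: scB {fast}; rewrite !inE.
by rewrite div1r ltf_pV2 ?posrE ?ltr0n // ltr_nat.
Qed.
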